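(* There exists an absolute constant $C>0$ such that the following holds. Let $n \ge 1$ and $d \ge 2$ be integers and let $G$ be a directed $d$-regular graph on $n$ vertices. Then the expected number of cycles in a uniformly random cycle-factor of $G$ is at most $C \cdot \frac{n \log d}{d}$, i.e. it is $\mathcal O((n\log d)/d)$.
   Context: A directed graph may have loops and directed cycles of length $2$, but no parallel edges. A directed graph is $d$-regular if the in-degree and out-degree of every vertex is exactly $d$ (a loop contributes one to each). A cycle-factor of a directed graph $G$ with vertex set $V$ is a partition of $V$ into directed cycles (loops counting as cycles of length $1$); equivalently, a permutation $\sigma$ of $V$ such that $(v,\sigma(v))$ is an edge of $G$ for every $v \in V$, and its cycles are the cycles of the permutation $\sigma$. Every directed $d$-regular graph has at least one cycle-factor; ''uniformly random'' means uniform over the finite set of all cycle-factors of $G$. *)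

(* Defs.v *)
From mathcomp Require Import all_boot all_fingroup.
From Stdlib Require Import Reals.
Set Implicit Arguments. Unset Strict Implicit. Unset Printing Implicit Defensive.

(* A directed graph on vertex set 'I_n is an edge relation E : rel 'I_n.
   Loops (E v v) and 2-cycles are allowed; parallel edges cannot occur. *)

Definition dregular (n d : nat) (E : rel 'I_n) : Prop :=
  forall v : 'I_n, #|[set w | E v w]| = d /\ #|[set u | E u v]| = d.

Definition is_cycle_factor (n : nat) (E : rel 'I_n) (s : {perm 'I_n}) : bool :=
  [forall v, E v (s v)].

(* Number of cycles of a cycle-factor = number of orbits of the permutation
   (fixed points / loops count as cycles of length 1). *)
Definition num_cycles (n : nat) (s : {perm 'I_n}) : nat := #|porbits s|.

Definition expected_num_cycles (n : nat) (E : rel 'I_n) : R :=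
  (INR (\sum_(s : {perm 'I_n} | is_cycle_factor E s) num_cycles s)
   / INR #|[set s : {perm 'I_n} | is_cycle_factor E s]|)%R.

(* Main.v *)
Require Import Defs.
From mathcomp Require Import all_boot all_fingroup all_order all_algebra.
From mathcomp Require Import ring lra.
From mathcomp Require Import reals sequences exp Rstruct Rstruct_topology.
Set Implicit Arguments. Unset Strict Implicit. Unset Printing Implicit Defensive.
Import Order.TTheory GRing.Theory Num.Theory.
Local Open Scope ring_scope.

(* Let P be the number of cycle-factors s. Fix an order t of the vertices and reveal s v in this order. When v is reached, at most N_v out-neighbours of v are still free, and at most one of them closes a cycle. Giving weight 2 to closing steps and 1 to the others, the products over v of w_v / (N_v + 1) sum to at most 1 over all s. By concavity of the logarithm, ln 2 times the total number of cycles plus P ln P is at most the sum over s and v of ln (N_v + 1). For a uniformly random order, N_v is uniform on {1, ..., d}, so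
     ln 2 * E[number of cycles] <= (n / d) (ln 2 + ... + ln (d + 1)) - ln P.
   The right-hand side is O(n ln d / d) because P >= (d / e)^n. This last bound follows Gurvits' capacity argument: columns are turned one at a time from being used any number of times to being used exactly once. Each such step needs only log-concavity of a generating polynomial in one variable, and here this comes from an exchange along alternating paths. *)

(** * Lower bound for the number of cycle-factors *)

Lemma connect_ind (T : finType) (e : rel T) (x : T) (P : T -> Prop) :
  P x -> (forall y z, connect e x y -> P y -> e y z -> P z) ->
  forall y, connect e x y -> P y.
Proof.
move=> Px step y /connectP[p]; elim/last_ind: p y => [|p z IHp] y /=.
  by move=> _ ->.
rewrite rcons_path last_rcons => /andP[path_p e_z] ->.
apply: step e_z; last exact: IHp.
by apply/connectP; exists p.
Qed.

Lemma ler_sum_inj (R : numDomainType) (I I' : finType) (P : pred I) (Q : pred I') (h : I -> I')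
    (F : I -> R) (G : I' -> R) :
  {in P &, injective h} -> (forall i, P i -> Q (h i) /\ F i = G (h i)) ->
  (forall j, Q j -> 0 <= G j) ->
  \sum_(i | P i) F i <= \sum_(j | Q j) G j.
Proof.
move=> h_inj hPQ G0.
have -> : \sum_(i | P i) F i = \sum_(j in h @: P) G j.
  by rewrite big_imset //=; apply: eq_bigr => i /hPQ[].
rewrite [leRHS](bigID (mem (h @: P))) /= (eq_bigl (fun j => Q j && (j \in h @: P))).
  by rewrite lerDl sumr_ge0 // => j /andP[/G0].
move=> j; case: (boolP (j \in _)) => [/imsetP[i iP ->]|]; last by rewrite andbF.
by case: (hPQ i iP) => ->.
Qed.

(** * Exchanging two functions along an alternating path *)

Section Exchange.
Variables (T J : finType).
Implicit Types (f g : {ffun T -> J}) (S : {set T}) (U : {set J}).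

Definition fiber f (j : J) : {set T} := [set i | f i == j].

(** [U] holds the columns already restricted to a single use: [U = set0] allows every function,
    while [U = setT] with [J = T] leaves the permutations. *)
Definition single_on U f : bool := [forall j in U, #|fiber f j| == 1%N].

Lemma single_on_inj U f i j :
  single_on U f -> f i \in U -> f j = f i -> j = i.
Proof.
move=> /forall_inP/(_ _)/[apply]/cards1P[a fib_a] fji.
have: i \in fiber f (f i) by rewrite inE.
have: j \in fiber f (f i) by rewrite inE fji.
by rewrite fib_a !inE => /eqP-> /eqP->.
Qed.

Lemma single_on_preim U f j : single_on U f -> j \in U -> exists i, f i = j.
Proof.
move=> /forall_inP/(_ _)/[apply]/cards1P[a fib_a]; exists a.
by have := set11 a; rewrite -fib_a inE => /eqP.
Qed.

Definition swap S f g : {ffun T -> J} := [ffun i => if i \in S then g i else f i].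

Lemma swapK S f g : swap S (swap S f g) (swap S g f) = f.
Proof. by apply/ffunP=> i; rewrite !ffunE; case: (i \in S). Qed.

Lemma fiber_swap S f g j :
  fiber (swap S f g) j =
  [set i | if i \in S then i \in fiber g j else i \in fiber f j].
Proof. by apply/setP=> i; rewrite !inE ffunE; case: ifP. Qed.

(** The alternating path from [x]: row [i] leads to column [g i], if this lies in [U], and then to a
    row that [f] sends to the same column. *)
Definition reach U f g (x : T) : {set T} :=
  [set i | connect (fun i k => (g i \in U) && (f k == g i)) x i].

Lemma reach_root U f g x : x \in reach U f g x.
Proof. by rewrite inE connect0. Qed.

Lemma reach_closed U f g x i k :
  i \in reach U f g x -> g i \in U -> f k = g i -> k \in reach U f g x.
Proof.
rewrite !inE => xi giU fk; apply: connect_trans xi (connect1 _).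
by rewrite giU fk eqxx.
Qed.

Lemma reach_ind U f g x (P : T -> Prop) :
  P x ->
  (forall i k, i \in reach U f g x -> P i -> g i \in U -> f k = g i -> P k) ->
  forall i, i \in reach U f g x -> P i.
Proof.
move=> Px step i; rewrite inE; apply: connect_ind => // y z xy Py /andP[gy /eqP fz].
by apply: step gy fz => //; rewrite inE.
Qed.

Section Path.
Variables (U : {set J}) (c : J) (f g : {ffun T -> J}) (x : T).
Hypotheses (cNU : c \notin U) (fU : single_on U f) (gU : single_on U g).
Hypotheses (fx : f x = c) (gc : fiber g c = set0).

Let S := reach U f g x.

Lemma reach_inv i : i \in S -> i = x \/ exists2 k, k \in S & g k \in U /\ f i = g k.
Proof.
move: i; apply: reach_ind; first by left.
by move=> i k iS _ giU fk; right; exists i.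
Qed.

Lemma reach_fiber i : i \in S -> f i = c -> i = x.
Proof. by case/reach_inv=> // -[k _ [gkU ->]] gkc; rewrite gkc (negPf cNU) in gkU. Qed.

(** A row [a] on the path with [f a] in [U] is not [x], so it was entered from a row that [g] sends
    to [f a]; this row is [b] because [g] uses a column of [U] only once. *)
Lemma reach_pair a b : g b \in U -> f a = g b -> (a \in S) = (b \in S).
Proof.
move=> gbU fab; apply/idP/idP=> [aS|bS]; last exact: reach_closed bS gbU fab.
case: (reach_inv aS) => [ax|[k kS [gkU fak]]].
  by move: gbU; rewrite -fab ax fx (negPf cNU).
by rewrite -(single_on_inj gU gbU (_ : g k = g b)) // -fak.
Qed.

(** By [reach_pair], the [f]-preimage and the [g]-preimage of a column of [U] are both on the path
    or both off it. *)
Lemma swap_single_on : single_on U (swap S f g) /\ single_on U (swap S g f).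
Proof.
have key j : j \in U -> exists a b, [/\ (a \in S) = (b \in S),
    fiber f j = [set a] & fiber g j = [set b]].
  move=> jU; have [a fa] := single_on_preim fU jU.
  have [b gb] := single_on_preim gU jU; exists a, b; split.
  - by apply: reach_pair; rewrite gb.
  - apply/setP=> i; rewrite !inE; apply/eqP/eqP=> [fi|->//].
    by apply: (single_on_inj fU); rewrite ?fa ?fi.
  - apply/setP=> i; rewrite !inE; apply/eqP/eqP=> [fi|->//].
    by apply: (single_on_inj gU); rewrite ?gb ?fi.
move: S key => S' key; split; apply/forall_inP=> j jU; have [a [b [ab fa gb]]] := key j jU;
  rewrite fiber_swap fa gb; apply/cards1P.
- exists (if b \in S' then b else a); apply/setP=> i; rewrite !inE.
  case: (boolP (b \in S')) => bS; case: ifP => iS //.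
  + apply/eqP/eqP=> E; first by rewrite E ab bS in iS.
    by rewrite E bS in iS.
  + apply/eqP/eqP=> E; first by rewrite E (negPf bS) in iS.
    by rewrite E ab (negPf bS) in iS.
- exists (if b \in S' then a else b); apply/setP=> i; rewrite !inE.
  case: (boolP (b \in S')) => bS; case: ifP => iS //.
  + apply/eqP/eqP=> E; first by rewrite E bS in iS.
    by rewrite E ab bS in iS.
  + apply/eqP/eqP=> E; first by rewrite E ab (negPf bS) in iS.
    by rewrite E (negPf bS) in iS.
Qed.

(** The path enters rows only through columns of [U], so [x] is its only row that [f] sends to [c]:
    exactly one use of [c] changes hands. *)
Lemma swap_fiber :
  fiber (swap S f g) c = fiber f c :\ x /\ fiber (swap S g f) c = [set x].
Proof.
have gNc i : g i != c.
  by have := in_set0 i; rewrite -gc inE => ->.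
have xS : x \in S by exact: reach_root.
split; apply/setP=> i; rewrite !inE ffunE; case: ifP => iS.
- rewrite (negPf (gNc i)); apply/esym/negP=> /andP[/eqP ix /eqP fi].
  by case: ix; exact: reach_fiber.
- by suff -> : i != x by []; apply: contraFN iS => /eqP->.
- by apply/eqP/eqP=> [|->//]; exact: reach_fiber.
- by rewrite (negPf (gNc i)); apply/esym; apply: contraFF iS => /eqP->.
Qed.

(** On the path, [swap S g f] is [f] and [swap S f g] is [g]; a step leaving the path would give [g]
    two preimages of a column of [U]. *)
Lemma swap_reach : reach U (swap S g f) (swap S f g) x = S.
Proof.
have H i : i \in reach U (swap S g f) (swap S f g) x -> i \in S.
  move: i; apply: reach_ind; first exact: reach_root.
  move=> i k _ iS; rewrite !ffunE iS; case: ifP => // kS giU gk.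
  by rewrite (single_on_inj gU giU gk) iS in kS.
apply/setP=> i; apply/idP/idP; first exact: H.
move: i; apply: reach_ind; first exact: reach_root.
move=> i k iS iS' giU fk; have kS : k \in S by apply: reach_closed iS giU fk.
by apply: reach_closed iS' _ _; rewrite !ffunE iS ?kS.
Qed.

End Path.

Variable R : realFieldType.
Implicit Types (w : T -> J -> R).

Definition weight w f : R := \prod_i w i (f i).

(* [wsum w setT] is the permanent of [w] for square [w]; [wsum w set0] is the product of its row sums. *)
Definition wsum w U : R := \sum_(f | single_on U f) weight w f.

(** The coefficient of [t ^+ k] in the polynomial obtained from [wsum w U] by multiplying column [c]
    by [t]. *)
Definition wsumk w U (c : J) (k : nat) : R :=
  \sum_(f | single_on U f && (#|fiber f c| == k)) weight w f.

Lemma weight_ge0 w f : (forall i j, 0 <= w i j) -> 0 <= weight w f.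
Proof. by move=> w0; apply: prodr_ge0. Qed.

Lemma weight_swap w S f g :
  weight w (swap S f g) * weight w (swap S g f) = weight w f * weight w g.
Proof.
rewrite -!big_split; apply: eq_bigr => i _ /=; rewrite !ffunE.
by case: ifP => _ //; rewrite mulrC.
Qed.

(* The alternating path of [f] and [g] leaving [x] through [c] is unaffected by exchanging [f] and [g] along it, which makes the exchange injective. *)
Lemma wsumk_exchange w U c k : (forall i j, 0 <= w i j) -> c \notin U ->
  k.+1%:R * wsumk w U c k.+1 * wsumk w U c 0 <= wsumk w U c k * wsumk w U c 1.
Proof.
move=> w0 cNU.
pose A m := [pred f | single_on U f && (#|fiber f c| == m)].
(* The marked point of the fiber of the first function over [c] accounts for the factor [k.+1], and
   the path starts there. *)
pose P := [pred t : {ffun T -> J} * {ffun T -> J} * T |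
  (t.1.1 \in A k.+1) && (t.1.2 \in A 0) && (t.1.1 t.2 == c)].
pose Q := [pred t : {ffun T -> J} * {ffun T -> J} | (t.1 \in A k) && (t.2 \in A 1%N)].
pose h (t : {ffun T -> J} * {ffun T -> J} * T) :=
  let S := reach U t.1.1 t.1.2 t.2 in (swap S t.1.1 t.1.2, swap S t.1.2 t.1.1).
have PE t : P t -> [/\ single_on U t.1.1, single_on U t.1.2, t.1.1 t.2 = c,
     fiber t.1.2 c = set0 & #|fiber t.1.1 c| = k.+1].
  case: t => -[f g] x /andP[/andP[/andP[/= fU /eqP fk] /andP[gU g0]] /eqP fx].
  by split=> //; apply/eqP; rewrite -cards_eq0.
have -> : k.+1%:R * wsumk w U c k.+1 * wsumk w U c 0 =
    \sum_(t | P t) weight w t.1.1 * weight w t.1.2.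
  rewrite -(pair_big_dep (fun p => (p.1 \in A k.+1) && (p.2 \in A 0))
     (fun p x => p.1 x == c) (fun p x => weight w p.1 * weight w p.2)) /=.
  rewrite -(pair_big (fun f => f \in A k.+1) (fun g => g \in A 0)
     (fun f g => \sum_(x | f x == c) weight w f * weight w g)) /=.
  rewrite -mulrA /wsumk mulr_suml mulr_sumr; apply: eq_bigr => f /andP[_ /eqP fk].
  rewrite !mulr_sumr; apply: eq_bigr => g _.
  rewrite (eq_bigl [in fiber f c]) => [|x]; last by rewrite !inE.
  by rewrite sumr_const fk mulr_natl.
have -> : wsumk w U c k * wsumk w U c 1 = \sum_(t | Q t) weight w t.1 * weight w t.2.
  rewrite -(pair_big (fun f => f \in A k) (fun g => g \in A 1%N)
     (fun f g => weight w f * weight w g)) /=.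
  by rewrite /wsumk mulr_suml; apply: eq_bigr => f _; rewrite mulr_sumr.
apply: (ler_sum_inj (h := h)).
- move=> t t' /PE[fU gU fx gc _] /PE[fU' gU' fx' gc' _].
  case: t t' fU gU fx gc fU' gU' fx' gc' => [[f g] x] [[f' g'] x'] /= fU gU fx gc fU' gU' fx' gc'.
  rewrite /h /=.
  have [_] := swap_fiber cNU fx gc; have [_] := swap_fiber cNU fx' gc'.
  have := swap_reach f x gU; have := swap_reach f' x' gU'.
  have := swapK (reach U f g x) f g; have := swapK (reach U f g x) g f.
  have := swapK (reach U f' g' x') f' g'; have := swapK (reach U f' g' x') g' f'.
  set S := reach U f g x; set S' := reach U f' g' x'.
  move=> K4 K3 K2 K1 r' r s' s [E1 E2].
  rewrite {}E2 {}E1 in K1 K2 r s.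
  (* The second exchanged function sends only [x] to [c]. Thus [x] is recovered, then the path, and
     exchanging again restores [f] and [g]. *)
  have xx : x = x' by apply/set1P; rewrite -s' s set11.
  have SS : S = S' by rewrite -[LHS]r -[RHS]r' xx.
  have -> : f = f' by rewrite -[LHS]K1 SS.
  have -> : g = g' by rewrite -[LHS]K2 SS.
  by rewrite xx.
- case=> [[f g] x] Pt; have [/= fU gU fx gc fk] := PE _ Pt.
  have [s1 s2] := swap_single_on cNU fU gU fx.
  have [c1 c2] := swap_fiber cNU fx gc.
  rewrite weight_swap; split=> //.
  rewrite /= !inE /= s1 s2 c1 c2 cards1 eqxx.
  have := cardsD1 x (fiber f c); rewrite fk inE fx eqxx add1n => -[<-].
  by rewrite eqxx.
- by move=> t _; rewrite mulr_ge0 ?weight_ge0.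
Qed.

End Exchange.

(** * The capacity argument, one column at a time *)

Section Capacity.
Variables (R : realFieldType) (T J : finType).
Implicit Types (w : T -> J -> R) (U : {set J}).

Definition scale_col w (c : J) (t : R) (i : T) (j : J) : R :=
  if j == c then t * w i j else w i j.

Lemma weight_scale_col w c t (f : {ffun T -> J}) :
  weight (scale_col w c t) f = t ^+ #|fiber f c| * weight w f.
Proof.
rewrite /weight /scale_col (bigID (fun i => f i == c)) /=.
rewrite [in RHS](bigID (fun i => f i == c)) /= mulrA; congr (_ * _); last first.
  by apply: eq_bigr => i /negPf->.
under eq_bigr => i -> do [].
rewrite big_split prodr_const; congr (_ ^+ _ * _).
by rewrite /fiber cardsE.
Qed.

Lemma wsum_scale_col w U c t :
  wsum (scale_col w c t) U = \sum_(k < #|T|.+1) t ^+ k * wsumk w U c k.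
Proof.
rewrite /wsum (partition_big (fun f => inord #|fiber f c| : 'I_#|T|.+1) xpredT) //=.
apply: eq_bigr => k _; rewrite /wsumk mulr_sumr.
have E (f : {ffun T -> J}) : (inord #|fiber f c| == k) = (#|fiber f c| == k).
  by rewrite -val_eqE /= inordK // ltnS max_card.
rewrite (eq_bigl (fun f => single_on U f && (#|fiber f c| == k))) => [|f]; last by rewrite E.
by apply: eq_bigr => f /andP[_ /eqP fk]; rewrite weight_scale_col fk.
Qed.

Lemma wsumk_ge0 w U c k : (forall i j, 0 <= w i j) -> 0 <= wsumk w U c k.
Proof. by move=> w0; apply: sumr_ge0 => f _; exact: weight_ge0. Qed.

(** Taking the linear coefficient in column [c] is what moves [c] into [U]. *)
Lemma wsumk1 w U c : c \notin U -> wsumk w U c 1 = wsum w (c |: U).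
Proof.
move=> cNU; apply: eq_bigl => f; apply/andP/forall_inP.
  by case=> /forall_inP fU fc j; rewrite !inE => /orP[/eqP->|/fU].
move=> fcU; split; last by apply: fcU; rewrite setU11.
by apply/forall_inP => j jU; apply: fcU; rewrite setU1r.
Qed.

(** The exchange inequality bounds the ratio of coefficients [k.+1] and [k] by [F1 / F0 / k.+1];
    iterating it compares the polynomial with [F0 * exp (t * F1 / F0)]. *)
Lemma wsumk_le_exp w U c k : (forall i j, 0 <= w i j) -> c \notin U ->
  0 < wsumk w U c 0 ->
  wsumk w U c k <= wsumk w U c 0 * (wsumk w U c 1 / wsumk w U c 0) ^+ k / k`!%:R.
Proof.
move=> w0 cNU F0; elim: k => [|k IHk]; first by rewrite expr0 fact0 mulr1 divr1.
have := wsumk_exchange k w0 cNU.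
rewrite -ler_pdivlMr // mulrC -ler_pdivlMr ?ltr0Sn // => /le_trans; apply.
rewrite factS natrM invfM exprS.
set F1 := wsumk w U c 1 in IHk *; set G := wsumk w U c 0 in F0 IHk *.
have -> : G * (F1 / G * (F1 / G) ^+ k) * (k.+1%:R^-1 * (k`!)%:R^-1) =
  G * (F1 / G) ^+ k / (k`!)%:R * (F1 / G / k.+1%:R) by ring.
rewrite -[_ * F1 / G]mulrA -[_ * (F1 / G) / _]mulrA; apply: ler_wpM2r => //.
by rewrite !mulr_ge0 ?invr_ge0 ?ler0n ?(ltW F0) ?wsumk_ge0.
Qed.

(** One step of Gurvits' argument: for p(t) = [wsum (scale_col w c t) U], a lower bound on p(t) / t
    yields one on p'(0), at the cost of a factor [K]. *)
Lemma wsum_derivative_ge w U c (K C : R) :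
  (forall i j, 0 <= w i j) -> c \notin U ->
  (forall m, \sum_(k < m) (k`!%:R)^-1 <= K) ->
  (forall t, 0 < t -> C * t <= wsum (scale_col w c t) U) ->
  C <= K * wsum w (c |: U).
Proof.
move=> w0 cNU HK HC; rewrite -wsumk1 //.
have K1 : 1 <= K by have := HK 1%N; rewrite big_ord1 fact0 invr1.
set F := wsumk w U c; have F_ge0 k : 0 <= F k by exact: wsumk_ge0.
have := F_ge0 0; rewrite le_eqVlt => /orP[/eqP F0|F0].
  (* With [F 0 = 0], p(t) / t tends to [F 1] as t tends to 0, and [t * B] bounds the error for t at
     most 1. *)
  have B0 : 0 <= \sum_(k < #|T|.+1) F k by exact: sumr_ge0.
  set B := (\sum_(k < _) _) in B0.
  have CB t : 0 < t -> t <= 1 -> C <= F 1%N + t * B.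
    move=> t0 t1; rewrite -(ler_pM2r t0).
    apply: le_trans (HC t t0) _; rewrite wsum_scale_col -/F.
    have -> : (F 1%N + t * B) * t = t * F 1%N + t ^+ 2 * B by ring.
    rewrite big_ord_recl -/(F _) -F0 mulr0 add0r.
    rewrite /B big_ord_recl -F0 add0r.
    case: #|T| => [|m]; first by rewrite !big_ord0 mulr0 addr0 mulr_ge0 ?(ltW t0).
    rewrite big_ord_recl /= expr1 lerD2l mulr_sumr.
    rewrite [leRHS]big_ord_recl /= -[leLHS]add0r lerD //.
      by rewrite mulr_ge0 // exprn_ge0 // ltW.
    apply: ler_sum => i _; rewrite ler_wpM2r //.
    by rewrite /bump /= !add1n 2!exprS expr2 mulrA ler_piMr ?sqr_ge0 // exprn_ile1 // ltW.
  apply: (@le_trans _ _ (F 1%N)); last by rewrite ler_peMl.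
  rewrite leNgt; apply/negP => lt_FC.
  set e := C - F 1%N; have e0 : 0 < e by rewrite subr_gt0.
  have D0 : 0 < e + B + 1 by lra.
  have := CB (e / (e + B + 1)).
  rewrite divr_gt0 // ler_pdivrMr // mul1r => /(_ isT).
  have -> : e <= e + B + 1 by lra.
  move=> /(_ isT); rewrite -lerBlDl -/e mulrAC ler_pdivlMr // ler_pM2l //; lra.
have Fk k : F k <= F 0 * (F 1%N / F 0) ^+ k / k`!%:R by exact: wsumk_le_exp.
have := F_ge0 1%N; rewrite le_eqVlt => /orP[/eqP F1|F1].
  (* With [F 1 = 0] all higher coefficients vanish, so p is constant and a large t refutes
     [0 < C]. *)
  rewrite -F1 mulr0 leNgt; apply/negP=> C0.
  have := HC ((F 0 + 1) / C); rewrite divr_gt0 ?addr_gt0 //.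
  rewrite [C * _]mulrC divfK ?gt_eqF // wsum_scale_col -/F big_ord_recl big1 => [|i _].
    by rewrite /= expr0 => /(_ isT); lra.
  have := Fk (lift ord0 i); rewrite -F1 mul0r /= /bump /= add1n exprS mul0r mulr0 mul0r => Fi.
  by rewrite (_ : F i.+1 = 0) ?mulr0 //; apply/eqP; rewrite eq_le Fi F_ge0.
(* This t minimises [F 0 * exp (t * F 1 / F 0) / t]; there the exponential majorant has the
   coefficients of the series of e. *)
have t0 : 0 < F 0 / F 1%N by rewrite divr_gt0.
have := HC _ t0; rewrite wsum_scale_col -/F => H.
have : C * (F 0 / F 1%N) <= F 0 * K.
  apply: le_trans H _; apply: (@le_trans _ _ (F 0 * \sum_(k < #|T|.+1) (k`!%:R)^-1)).
    rewrite mulr_sumr; apply: ler_sum => k _.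
    apply: le_trans (ler_wpM2l (exprn_ge0 _ (ltW t0)) (Fk k)) _.
    rewrite mulrA mulrCA -exprMn mulrA divfK ?gt_eqF // divff ?gt_eqF //.
    by rewrite expr1n mulr1.
  by rewrite ler_pM2l.
by rewrite mulrCA ler_pM2l // ler_pdivrMr // mulrC.
Qed.

(** Induction on [U]: each column made single costs one factor [K]. *)
Lemma capacity_le_wsum (a : T -> J -> R) (K : R) :
  (forall i j, 0 <= a i j) -> (forall m, \sum_(k < m) (k`!%:R)^-1 <= K) ->
  (forall x : J -> R, (forall j, 0 < x j) ->
     \prod_j x j <= wsum (fun i j => a i j * x j) set0) ->
  forall U (x : J -> R), (forall j, 0 < x j) ->
    \prod_j x j <= K ^+ #|U| * wsum (fun i j => a i j * x j) U.
Proof.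
move=> a0 HK base U; have [m] := ubnP #|U|; elim: m U => // m IHm U ltUm x x0.
have K0 : 0 < K by have := HK 1%N; rewrite big_ord1 fact0 invr1; apply: lt_le_trans.
case: (set_0Vmem U) => [->|[c cU]]; first by rewrite cards0 expr0 mul1r; exact: base.
have cNU : c \notin U :\ c by rewrite setD11.
rewrite -(setD1K cU) cardsU1 cNU add1n exprSr -mulrA -ler_pdivrMl ?exprn_gt0 //.
apply: wsum_derivative_ge => // [i j|t t0]; first by rewrite mulr_ge0 // ltW.
rewrite -mulrA ler_pdivrMl ?exprn_gt0 //.
(* Scaling column [c] by [t] amounts to scaling [x c], so the induction hypothesis at [y] gives a
   lower bound linear in [t]. *)
pose y j := if j == c then t * x j else x j.
have y0 j : 0 < y j by rewrite /y; case: ifP => // _; rewrite mulr_gt0.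
have ltUcm : (#|U :\ c| < m)%N by move: ltUm; rewrite (cardsD1 c U) cU add1n ltnS.
have := IHm (U :\ c) ltUcm y y0; congr (_ <= _ * _).
  rewrite (bigD1 c) //= [in RHS](bigD1 c) //= /y eqxx -mulrA mulrC; congr (_ * _).
  by congr (_ * _); apply: eq_bigr => j /negPf->.
apply: eq_bigr => f _; apply: eq_bigr => i _; rewrite /scale_col /y.
by case: ifP => _ //; rewrite mulrCA.
Qed.

End Capacity.

(** * Counting the cycle-factors of a regular digraph *)

Lemma sum_single_on_perm (R : realFieldType) (T : finType) (F : {ffun T -> T} -> R) :
  \sum_(f | single_on setT f) F f = \sum_(s : {perm T}) F (pval s).
Proof.
rewrite (reindex (fun s : {perm T} => pval s)) /=.
  apply: eq_bigl => s; apply/forall_inP => j _; apply/cards1P.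
  exists ((s^-1)%g j); apply/setP=> i; rewrite !inE.
  by rewrite pvalE; apply/eqP/eqP => [<-|->]; rewrite ?permK ?permKV.
exists (insubd (1%g : {perm T})) => [s _|f fT]; first by rewrite valKd.
apply: insubdK; apply/injectiveP => i j fij.
by apply: single_on_inj fT _ fij; rewrite inE.
Qed.

(* AM-GM on each row; column regularity makes every [x j] occur exactly [d] times. *)
Lemma regular_capacity (R : realFieldType) (T : finType) (E : rel T) d (x : T -> R) :
  (0 < d)%N -> (forall v, #|[set w | E v w]| = d) ->
  (forall v, #|[set u | E u v]| = d) -> (forall j, 0 < x j) ->
  \prod_j x j <= \prod_i \sum_j (E i j)%:R / d%:R * x j.
Proof.
(* Comparing [d]-th powers avoids the roots in AM-GM. *)
move=> d0 Eout Ein x0; rewrite -(ler_pXn2r d0) ?nnegrE; first last.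
- by apply: prodr_ge0 => i _; apply: sumr_ge0 => j _; rewrite !mulr_ge0 ?invr_ge0 ?ler0n ?ltW.
- by apply: prodr_ge0 => i _; rewrite ltW.
have -> : (\prod_j x j) ^+ d = \prod_i \prod_(j in [set w | E i w]) x j.
  rewrite -prodrXl (exchange_big_dep xpredT) //=; apply: eq_bigr => j _.
  rewrite -[in LHS](Ein j) -prodr_const; apply: eq_bigl => i.
  by rewrite !inE.
rewrite -prodrXl; apply: ler_prod => i _; apply/andP; split.
  by apply: prodr_ge0 => j _; rewrite ltW.
have := @leif_AGM R T [set w | E i w] x; rewrite Eout => -[|H _].
  by move=> j _; rewrite ltW.
apply: le_trans H _; rewrite le_eqVlt; apply/orP; left; apply/eqP; congr (_ ^+ _).
rewrite mulr_suml big_mkcond; apply: eq_bigr => j _; rewrite inE.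
by case: (E i j); rewrite ?mul0r // mul1r mulrC.
Qed.

(** The capacity bound at [x = 1] for the matrix [E / d], in whose permanent each cycle-factor has
    weight [d ^- #|T|]. *)
Lemma cycle_factor_count_ge (R : realFieldType) (T : finType) (E : rel T) d (K : R) :
  (0 < d)%N -> (forall v, #|[set w | E v w]| = d) ->
  (forall v, #|[set u | E u v]| = d) ->
  (forall m, \sum_(k < m) (k`!%:R)^-1 <= K) ->
  d%:R ^+ #|T| <= K ^+ #|T| * #|[set s : {perm T} | [forall v, E v (s v)]]|%:R.
Proof.
move=> d0 Eout Ein HK.
have a0 i j : 0 <= (E i j)%:R / d%:R :> R by rewrite divr_ge0.
have base (x : T -> R) : (forall j, 0 < x j) ->
    \prod_j x j <= wsum (fun i j => (E i j)%:R / d%:R * x j) set0.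
  move=> x0; apply: le_trans (regular_capacity d0 Eout Ein x0) _.
  rewrite bigA_distr_bigA /= le_eqVlt; apply/orP; left; apply/eqP.
  by apply: eq_bigl => f; apply/esym/forall_inP=> j; rewrite inE.
have := capacity_le_wsum a0 HK base setT (fun _ => ltr01).
rewrite big1 // cardsT /wsum sum_single_on_perm => H.
have dn0 : 0 < d%:R ^+ #|T| :> R by rewrite exprn_gt0 // ltr0n.
have W (s : {perm T}) : weight (fun i j : T => (E i j)%:R / d%:R * 1) (pval s) =
    (if [forall v, E v (s v)] then d%:R ^- #|T| else 0) :> R.
  rewrite /weight; case: ifPn => [/forallP sE|].
    under eq_bigr => i _ do rewrite mulr1 pvalE sE mul1r.
    by rewrite prodr_const exprVn.
  case/forallPn=> v /negPf Ev; rewrite (bigD1 v) //= pvalE Ev !mul0r //.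
move: H; rewrite (eq_bigr _ (fun s _ => W s)) -big_mkcond sumr_const -cardsE.
by rewrite -[_ ^- _ *+ _]mulr_natl mulrA ler_pdivlMr ?mul1r.
Qed.

(** * Revealing a permutation in a given order *)

Section Exploration.
Variables (n : nat) (E : rel 'I_n) (t : {perm 'I_n}).
Implicit Types (s : {perm 'I_n}) (u v x : 'I_n).

(* [v] is revealed last in its [s]-cycle, i.e. revealing [s v] closes the cycle. *)
Definition closes s v : bool := [forall u in porbit s v, (t u <= t v)%N].

Definition rank (S : {set 'I_n}) v : nat := #|[set u in S | (t v <= t u)%N]|.

(** The out-neighbours of [v], represented by their [s]-preimages. Those not before [v] in the order
    are the out-neighbours still free, so [rank t (successors E s v) v] is N_v. *)
Definition successors s v : {set 'I_n} := [set u | E v (s u)].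

Lemma rank_inj (S : {set 'I_n}) v v' : v \in S -> v' \in S -> rank S v = rank S v' -> v = v'.
Proof.
have lt_rank a b : a \in S -> (t a < t b)%N -> (rank S b < rank S a)%N.
  move=> aS ab; apply: proper_card; apply/properP; split.
    by apply/subsetP=> u; rewrite !inE => /andP[-> /(leq_trans (ltnW ab))].
  by exists a; rewrite !inE aS ?leqnn //= -ltnNge.
move=> vS v'S rE; case: (ltngtP (t v) (t v')) => [lt|lt|].
- by have := lt_rank _ _ vS lt; rewrite rE ltnn.
- by have := lt_rank _ _ v'S lt; rewrite rE ltnn.
- by move/val_inj/perm_inj.
Qed.

(** Each cycle has exactly one closing vertex, its latest in the order [t]. *)
Lemma card_closes s : #|[set v | closes s v]| = #|porbits s|.
Proof.
have <- : porbit s @: [set v | closes s v] = porbits s.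
  apply/setP=> X; apply/imsetP/imsetP => [[v _ ->]|[v _ ->]]; first by exists v.
  have [w wv max_w] := @arg_maxnP _ v [in porbit s v] (fun u => t u : nat) (porbit_id s v).
  exists w; last by apply/eqP; rewrite eq_porbit_mem porbit_sym.
  rewrite inE; apply/forall_inP=> u uw; apply: max_w.
  by move: wv; rewrite /= -eq_porbit_mem => /eqP <-.
rewrite card_in_imset // => v v'; rewrite !inE => /forall_inP cv /forall_inP cv' vv'.
apply: (@perm_inj _ t); apply: val_inj; apply/eqP; rewrite eqn_leq.
by rewrite cv' -?vv' ?porbit_id // cv // vv' porbit_id.
Qed.

Definition agree (i : nat) s s' : bool := [forall u, (t u < i)%N ==> (s' u == s u)].

Lemma agreeP i s s' : reflect (forall u, (t u < i)%N -> s' u = s u) (agree i s s').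
Proof.
apply: (iffP forallP) => H u; first by move=> ui; apply/eqP; apply: (implyP (H u)).
by apply/implyP => /H/eqP.
Qed.

(* The [s]-cycle of [v] is contained in its [s']-cycle, because before [v] the two permutations agree; so [s v] has an [s']-preimage in that cycle, which can only be [v]. *)
Lemma closes_unique s s' v : agree (t v) s s' -> closes s v -> closes s' v -> s v = s' v.
Proof.
move=> /agreeP ss' /forall_inP cs /forall_inP cs'.
have lt_v u : (t u <= t v)%N -> u != v -> (t u < t v)%N.
  by rewrite leq_eqVlt => /orP[/eqP/val_inj/perm_inj->|//]; rewrite eqxx.
have sub k : (s^-1 ^+ k)%g v \in porbit s' v.
  elim: k => [|k IHk]; first by rewrite expg0 perm1 porbit_id.
  rewrite expgSr permM; set w := (s^-1 ^+ k)%g v in IHk *.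
  set u := (s^-1)%g w; have su : s u = w by rewrite /u permKV.
  have [->|uv] := eqVneq u v; first exact: porbit_id.
  have uO : u \in porbit s v by rewrite -[s]invgK -porbitV invgK /u /w -permM -expgSr mem_porbit.
  by rewrite porbit_sym -(porbit_perm s' 1) expg1 ss' ?lt_v ?cs // su porbit_sym.
have /porbitP[k sk] : s v \in porbit (s^-1)%g v.
  by rewrite porbitV; have := mem_porbit s 1 v; rewrite expg1.
have := sub k; rewrite -sk => svO.
set u := (s'^-1)%g (s v); have s'u : s' u = s v by rewrite permKV.
have uO : u \in porbit s' v.
  by rewrite porbit_sym -(porbit_perm s' 1) expg1 s'u porbit_sym.
have [uv|uv] := eqVneq u v; first by rewrite -[in RHS]uv.
by have := ss' u (lt_v u (cs' u uO) uv); rewrite s'u => /perm_inj/eqP; rewrite eq_sym (negPf uv).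
Qed.

End Exploration.

Section Seq.
Variables (R : realFieldType) (n : nat) (E : rel 'I_n) (t : {perm 'I_n}).
Implicit Types (s : {perm 'I_n}) (u v x : 'I_n).

Definition step_weight s v : R :=
  (1 + closes t s v)%:R / (rank t (successors E s v) v).+1%:R.

Let factor s := [forall v, E v (s v)].

Lemma step_weight_ge0 s v : 0 <= step_weight s v.
Proof. by rewrite divr_ge0. Qed.

(** N_v depends only on the values revealed before [v]. *)
Lemma rank_successors s0 s v : agree t (t v) s0 s ->
  rank t (successors E s v) v =
  #|[set x | E v x & x \notin s0 @: [set u | (t u < t v)%N]]|.
Proof.
move=> /agreeP ag; rewrite /rank -(card_imset _ (@perm_inj _ s)); congr #|pred_of_set _|.
apply/setP=> x; rewrite -{1}[x](permKV s) mem_imset; last exact: perm_inj.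
rewrite !inE permKV leqNgt; congr (_ && ~~ _).
apply/idP/imsetP => [lt|[u]]; first by exists ((s^-1)%g x); rewrite ?inE // -ag // permKV.
by rewrite inE => uv ->; rewrite -ag // permK.
Qed.

(* Conditionally on the values at vertices before [v], there are [rank] possible values at [v], of which at most one closes a cycle. *)
Lemma sum_step_weight_suffix k i s0 : (i + k)%N = n ->
  \sum_(s | factor s && agree t i s0 s) \prod_(v | (i <= t v)%N) step_weight s v <= 1.
Proof.
elim: k i s0 => [|k IHk] i s0.
  rewrite addn0 => ->.
  have ltn v : (t v < n)%N by [].
  (* All values are prescribed: at most one permutation is left, with an empty product. *)
  rewrite (eq_bigr (fun=> 1)) => [|s _]; last first.
    by rewrite big_pred0 // => v; apply/negbTE; rewrite -ltnNge.
  rewrite sumr_const lern1; apply/card_le1_eqP => s s'.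
  move=> /andP[_ /agreeP ag] /andP[_ /agreeP ag'].
  by apply/permP=> u; rewrite ag ?ag'.
move=> ikn; have lt_in : (i < n)%N by rewrite -ikn -addSnnS leq_addr.
pose v := (t^-1)%g (Ordinal lt_in).
have tv : t v = i :> nat by rewrite permKV.
pose A := [set x | E v x & x \notin s0 @: [set u | (t u < t v)%N]].
pose C := [set x | [exists s, [&& factor s, agree t i s0 s, closes t s v & s v == x]]].
have C1 : (#|C| <= 1)%N.
  apply/card_le1_eqP => x y; rewrite !inE.
  case/existsP=> s /and4P[_ ag c /eqP<-] /existsP[s' /and4P[_ ag' c' /eqP<-]].
  apply/esym/(closes_unique _ c c')/agreeP=> u; rewrite tv => ui.
  by rewrite (agreeP _ _ _ _ ag') // (agreeP _ _ _ _ ag).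
have D0 : 0 < #|A|.+1%:R :> R by rewrite ltr0Sn.
(* [b x] bounds the contribution of the permutations with [s v = x]; the sum of all [b x] is at most
   [(#|A| + #|C|) / (#|A| + 1)]. *)
pose b x : R := if x \in A then (1 + (x \in C))%:R / #|A|.+1%:R else 0.
apply: (@le_trans _ _ (\sum_x b x)); last first.
  rewrite -big_mkcond -mulr_suml ler_pdivrMr // mul1r -natr_sum ler_nat.
  rewrite big_split sum1_card -addn1 leq_add2l (leq_trans _ C1) //.
  rewrite -sum1_card [leqRHS]big_mkcond [leqLHS]big_mkcond; apply: leq_sum => x _.
  by case: (x \in A); case: (x \in C).
rewrite (partition_big (fun s => s v) xpredT) //=; apply: ler_sum => x _.
have [s1 /andP[/andP[s1F s1ag] /eqP s1v]|none] := pickP (fun s => factor s && agree t i s0 s && (s v == x)); last first.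
  by rewrite big_pred0 // /b; case: ifP => // _; rewrite divr_ge0.
have xA : x \in A.
  rewrite inE -{1}s1v (forallP s1F) /=; apply/imsetP=> -[u]; rewrite inE => uv.
  rewrite -(agreeP _ _ _ _ s1ag) -?tv // -s1v => /perm_inj vu.
  by rewrite vu ltnn in uv.
rewrite /b xA.
(* Any [s1] in the class serves as the new reference: agreeing with it through position [i] means
   agreeing with [s0] before [i] and taking the value [x] at [v]. *)
apply: (@le_trans _ _ (\sum_(s | factor s && agree t i.+1 s1 s)
    (1 + (x \in C))%:R / #|A|.+1%:R * \prod_(u | (i.+1 <= t u)%N) step_weight s u)).
  rewrite (eq_bigl (fun s => factor s && agree t i.+1 s1 s)) => [|s]; last first.
    rewrite -andbA; congr (_ && _); apply/andP/agreeP.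
      move=> [/agreeP ag /eqP sv] u; rewrite ltnS leq_eqVlt => /orP[/eqP|] ui.
        by have -> : u = v; [apply/(@perm_inj _ t)/val_inj; rewrite /= ui tv|rewrite s1v].
      by rewrite ag // (agreeP _ _ _ _ s1ag).
    move=> ag; split; last by rewrite ag ?tv // s1v.
    by apply/agreeP=> u ui; rewrite ag ?(leq_trans ui) // (agreeP _ _ _ _ s1ag).
  apply: ler_sum => s /andP[sF /agreeP ag].
  have ag0 : agree t i s0 s.
    by apply/agreeP=> u ui; rewrite ag ?(leq_trans ui) // (agreeP _ _ _ _ s1ag).
  rewrite (bigD1 v) ?tv //=.
  rewrite (eq_bigl (fun u => (i < t u)%N)) => [|u]; last first.
    rewrite ltn_neqAle andbC; congr (_ && _).
    rewrite -tv [in RHS]eq_sym; congr (~~ _).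
    by apply/eqP/eqP => [->//|/val_inj/perm_inj].
  apply: ler_wpM2r; first by apply: prodr_ge0 => u _; exact: step_weight_ge0.
  rewrite /step_weight (rank_successors (s0 := s0)) ?tv //.
  rewrite -tv ler_wpM2r ?invr_ge0 // ler_nat leq_add2l.
  case: (boolP (closes t s v)) => //= sc.
  rewrite lt0b inE; apply/existsP; exists s.
  by rewrite sF ag0 sc ag ?tv // s1v eqxx.
rewrite -mulr_sumr ler_piMr ?divr_ge0 //.
by apply: IHk; rewrite addSnnS.
Qed.

Lemma sum_step_weight : \sum_(s | factor s) \prod_v step_weight s v <= 1.
Proof.
have := sum_step_weight_suffix (k := n) 1%g (add0n n).
by under eq_bigl => s do
  rewrite (introT (agreeP _ _ _ _) (fun u (h : (t u < 0)%N) => False_ind _ (notF h))) andbT.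
Qed.

End Seq.

(** * Averaging over the order *)

(** [rank t S] is a bijection from [S] onto {1, ..., [#|S|]}. *)
Lemma sum_rank (V : nmodType) n (t : {perm 'I_n}) (S : {set 'I_n}) (f : nat -> V) :
  \sum_(v in S) f (rank t S v) = \sum_(k < #|S|) f k.+1.
Proof.
have rank_gt0 v : v \in S -> (0 < rank t S v)%N.
  by move=> vS; apply/card_gt0P; exists v; rewrite !inE vS leqnn.
have rank_le v : (rank t S v <= #|S|)%N.
  by apply/subset_leq_card/subsetP=> u; rewrite inE => /andP[].
case: (set_0Vmem S) => [->|[v0 v0S]]; first by rewrite cards0 big_set0 big_ord0.
have S0 : (0 < #|S|)%N by apply/card_gt0P; exists v0.
pose h v : 'I_#|S| := insubd (Ordinal S0) (rank t S v).-1.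
have hE v : v \in S -> (h v).+1 = rank t S v.
  move=> vS; rewrite val_insubd prednK ?rank_gt0 //.
  by rewrite rank_le prednK ?rank_gt0.
have h_inj : {in S &, injective h}.
  move=> v v' vS v'S hh; apply: (@rank_inj n t S) => //.
  by rewrite -!hE // hh.
have hS : h @: S = setT.
  by apply/eqP; rewrite eqEcard subsetT cardsT card_ord card_in_imset // leqnn.
transitivity (\sum_(k in h @: S) f k.+1); last by apply: eq_bigl => k; rewrite hS inE.
by rewrite big_imset //=; apply: eq_bigr => v vS; rewrite hE.
Qed.

(** Precomposing orders with [tperm v u] shows that all members of [S] have the same rank
    distribution; summing over [S] then reduces to [sum_rank]. *)
Lemma sum_perm_rank (V : nmodType) n (S : {set 'I_n}) v (f : nat -> V) : v \in S ->
  (\sum_(t : {perm 'I_n}) f (rank t S v)) *+ #|S| = (\sum_(k < #|S|) f k.+1) *+ n`!.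
Proof.
move=> vS.
have rank_tperm u (t : {perm 'I_n}) : u \in S -> rank (tperm v u * t) S v = rank t S u.
  move=> uS; rewrite /rank -(card_imset _ (@perm_inj _ (tperm v u))); congr #|pred_of_set _|.
  apply/setP=> w; rewrite -{1}[w](tpermK v u) mem_imset; last exact: perm_inj.
  rewrite !inE !permM tpermL tpermK; congr (_ && _).
  by case: tpermP => [->|->|//]; rewrite ?vS uS.
rewrite -sumr_const (eq_bigr (fun u => \sum_(t : {perm 'I_n}) f (rank t S u))) => [|u uS].
  rewrite exchange_big /= (eq_bigr (fun=> \sum_(k < #|S|) f k.+1)) => [|t _]; last exact: sum_rank.
  by rewrite sumr_const card_Sn.
rewrite (reindex_inj (mulgI (tperm v u))); apply: eq_bigr => t _.
by rewrite rank_tperm.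
Qed.

(** * Entropy bound on the total number of cycles *)

(** Jensen's inequality, from [ln y <= y - 1] at [y = #|A| * q i]. *)
Lemma sum_ln_le (R : realType) (I : finType) (A : {pred I}) (q : I -> R) :
  (forall i, i \in A -> 0 < q i) -> \sum_(i in A) q i <= 1 ->
  \sum_(i in A) ln (q i) <= - (#|A|%:R * ln #|A|%:R).
Proof.
move=> q0 q1; have [A0|A0] := posnP #|A|.
  by rewrite A0 mul0r oppr0 big_pred0 // => i; apply/card0_eq.
have P0 : 0 < #|A|%:R :> R by rewrite ltr0n.
have : \sum_(i in A) ln (#|A|%:R * q i) <= 0.
  apply: (@le_trans _ _ (\sum_(i in A) (#|A|%:R * q i - 1))).
    apply: ler_sum => i iA; rewrite -{1}[X in ln X](subrK 1) addrC le_ln1Dx //.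
    by rewrite ltrBrDr addrC subrr mulr_gt0 ?q0.
  by rewrite sumrB -mulr_sumr sumr_const subr_le0 ler_piMr // ltW.
rewrite (eq_bigr (fun i => ln #|A|%:R + ln (q i))) => [|i iA]; last first.
  by rewrite lnM ?posrE ?q0.
by rewrite big_split sumr_const -[_ *+ _]mulr_natl /=; lra.
Qed.

Lemma ln_prod (R : realType) (I : finType) (F : I -> R) :
  (forall i, 0 < F i) -> ln (\prod_i F i) = \sum_i ln (F i).
Proof.
move=> F0; suff [] : 0 < \prod_i F i /\ ln (\prod_i F i) = \sum_i ln (F i) by [].
elim/big_rec2: _ => [|i x y _ [y0 xy]]; first by rewrite ltr01 ln1.
by rewrite mulr_gt0 // lnM ?posrE // xy.
Qed.

Section Upper.
Variables (R : realType) (n d : nat) (E : rel 'I_n).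
Hypothesis Eout : forall v, #|[set w | E v w]| = d.
Let factors := [set s : {perm 'I_n} | [forall v, E v (s v)]].

Lemma card_successors (s : {perm 'I_n}) v : #|successors E s v| = d.
Proof.
rewrite -(Eout v) -(card_imset _ (@perm_inj _ s)); congr #|pred_of_set _|.
apply/setP=> w; rewrite -[w](permKV s) mem_imset; last exact: perm_inj.
by rewrite !inE permKV.
Qed.

(** [sum_ln_le] for the products of step weights, whose logarithms contain one [ln 2] per closing
    vertex, that is, per cycle. *)
Lemma entropy_bound (t : {perm 'I_n}) :
  ln 2 * (\sum_(s in factors) #|porbits s|)%:R + #|factors|%:R * ln #|factors|%:R
  <= \sum_(s in factors) \sum_v ln (rank t (successors E s v) v).+1%:R :> R.
Proof.
have w0 s v : 0 < step_weight R E t s v by rewrite divr_gt0 ?ltr0n.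
have Q0 s : s \in factors -> 0 < \prod_v step_weight R E t s v.
  by move=> _; apply: prodr_gt0 => v _.
have Q1 : \sum_(s in factors) \prod_v step_weight R E t s v <= 1.
  by rewrite (eq_bigl (fun s : {perm 'I_n} => [forall v, E v (s v)])) ?sum_step_weight // => s; rewrite inE.
have := sum_ln_le Q0 Q1.
have -> : \sum_(s in factors) ln (\prod_v step_weight R E t s v) =
   ln 2 * (\sum_(s in factors) #|porbits s|)%:R
   - \sum_(s in factors) \sum_v ln (rank t (successors E s v) v).+1%:R.
  rewrite natr_sum mulr_sumr -sumrB; apply: eq_bigr => s _.
  rewrite ln_prod //.
  rewrite -(card_closes t) -sum1_card natr_sum mulr_sumr [X in X - _]big_mkcond -sumrB.
  apply: eq_bigr => v _; rewrite /step_weight ln_div ?posrE ?ltr0n // inE.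
  by case: (closes t s v); rewrite ?mulr1 // ln1.
lra.
Qed.

(** Sum of [entropy_bound] over all orders: [v] belongs to its [d]-element set [successors E s v],
    so its rank there is uniform on {1, ..., d}. *)
Lemma sum_porbits_le :
  (ln 2 * (\sum_(s in factors) #|porbits s|)%:R + #|factors|%:R * ln #|factors|%:R) * d%:R
  <= #|factors|%:R * n%:R * \sum_(k < d) ln k.+2%:R :> R.
Proof.
have nf0 : 0 < n`!%:R :> R by rewrite ltr0n fact_gt0.
rewrite -(ler_pM2r nf0).
set X := ln 2 * _ + _.
have H : \sum_(t : {perm 'I_n}) X <= \sum_(t : {perm 'I_n})
    \sum_(s in factors) \sum_v ln (rank t (successors E s v) v).+1%:R.
  by apply: ler_sum => t _; exact: entropy_bound.
rewrite sumr_const card_Sn in H.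
rewrite mulrAC [X * _]mulr_natr -!mulrA [_ * n`!%:R]mulr_natr.
apply: le_trans (ler_wpM2r (ler0n _ d) H) _.
rewrite exchange_big mulr_suml le_eqVlt; apply/orP; left; apply/eqP.
rewrite mulr_natl -sumr_const; apply: eq_bigr => s.
rewrite inE => /forallP sE; rewrite exchange_big mulr_suml mulr_natl.
rewrite -[X in _ = _ *+ X](card_ord n) -sumr_const; apply: eq_bigr => v _.
have vS : v \in successors E s v by rewrite inE sE.
have := sum_perm_rank (fun k => ln k.+1%:R : R) vS.
by rewrite card_successors mulr_natr.
Qed.

End Upper.

(** * Numerical estimates and conclusion *)

Lemma sum_inv_fact_le (R : realType) m : \sum_(k < m) (k`!%:R)^-1 <= expR 1 :> R.
Proof.
have -> : \sum_(k < m) (k`!%:R)^-1 = series (exp_coeff (1 : R)) m.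
  rewrite /series /= big_mkord; apply: eq_bigr => k _.
  by rewrite /exp_coeff /= expr1n mul1r.
apply: nondecreasing_cvgn_le; last exact: is_cvg_series_exp_coeff.
apply: nondecreasing_series => k _ _.
by rewrite /exp_coeff /= expr1n mul1r invr_ge0.
Qed.

(** Both sides are [ln (1 + x) <= x], at [x = - 1 / (m + 1)] and at [x = 1 / m]. *)
Lemma ln_succ_sub (R : realType) (m : nat) : (0 < m)%N ->
  m.+1%:R^-1 <= ln (m.+1%:R : R) - ln m%:R <= m%:R^-1.
Proof.
move=> m0; have m0' : 0 < m%:R :> R by rewrite ltr0n.
have m1 : 0 < m.+1%:R :> R by rewrite ltr0n.
apply/andP; split.
  have := @le_ln1Dx R (- m.+1%:R^-1).
  have -> : 1 - m.+1%:R^-1 = m%:R / m.+1%:R :> R.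
    by rewrite -[m.+1%:R]natr1; field; rewrite natr1 gt_eqF.
  rewrite ln_div ?posrE // ltrN2 invf_lt1 // ltr1n ltnS m0 => /(_ isT).
  by rewrite lerNr opprB; apply.
have := @le_ln1Dx R m%:R^-1.
have -> : 1 + m%:R^-1 = m.+1%:R / m%:R :> R.
  by rewrite -[m.+1%:R]natr1; field; rewrite gt_eqF.
rewrite ln_div ?posrE // => H; apply: H.
by apply: lt_trans (ltrN10 _) _; rewrite invr_gt0.
Qed.

Lemma half_le_ln2 (R : realType) : 2^-1 <= ln 2 :> R.
Proof. by have /andP[] := @ln_succ_sub R 1 isT; rewrite ln1 subr0. Qed.

(** A Stirling bound for ln (d + 1)!, with a main term matching the lower bound on ln P. *)
Lemma sum_ln_succ_le (R : realType) (d : nat) : (0 < d)%N ->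
  \sum_(k < d) ln k.+2%:R <= d%:R * (ln d%:R - 1) + 2 * (ln d%:R + 1) :> R.
Proof.
case: d => // d _; elim: d => [|d IHd].
  have /andP[_ +] := @ln_succ_sub R 1 isT.
  rewrite big_ord1 ln1; lra.
rewrite big_ord_recr /=; apply: le_trans (lerD IHd (lexx _)) _.
have /andP[h1 _] := @ln_succ_sub R d.+1 isT.
have /andP[_ h2] := @ln_succ_sub R d.+2 isT.
have d0 : 0 < d.+2%:R :> R by rewrite ltr0n.
move: h1 h2; rewrite -[d.+2%:R]natr1 in d0 *.
set D := d.+1%:R in d0 *; set a := ln D; set b := ln (D + 1); set c := ln _.
move=> h1 h2.
(* The right-hand side grows by [(D + 2) * (b - a) + b - 1], at least [b + 1 / (D + 1)], hence at
   least [c]. *)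
have : (D + 2) * (D + 1)^-1 <= (D + 2) * (b - a).
  by apply: ler_wpM2l => //; lra.
have -> : (D + 2) * (D + 1)^-1 = 1 + (D + 1)^-1.
  by apply: (canLR (mulfK _)); rewrite ?gt_eqF // mulrDl mulVf ?gt_eqF //; ring.
lra.
Qed.

Lemma mean_porbits_le (R : realType) (n d : nat) (E : rel 'I_n) :
  (2 <= d)%N -> (forall v, #|[set w | E v w]| = d) ->
  (forall v, #|[set u | E u v]| = d) ->
  (\sum_(s : {perm 'I_n} | [forall v, E v (s v)]) #|porbits s|)%:R
    / #|[set s : {perm 'I_n} | [forall v, E v (s v)]]|%:R <=
  12 * (n%:R * ln d%:R / d%:R) :> R.
Proof.
move=> d2 Eout Ein; set factors := [set s | _].
rewrite (eq_bigl [in factors]) => [|s]; last by rewrite inE.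
have d0 : (0 < d)%N by apply: leq_trans d2.
have d0' : 0 < d%:R :> R by rewrite ltr0n.
have := cycle_factor_count_ge d0 Eout Ein (@sum_inv_fact_le R).
rewrite card_ord -/factors => lower.
(* The lower bound also shows that a cycle-factor exists. *)
have P0 : 0 < #|factors|%:R :> R.
  by rewrite -(pmulr_rgt0 _ (exprn_gt0 n (expR_gt0 (1 : R)))) (lt_le_trans _ lower) ?exprn_gt0.
have lnP : n%:R * (ln d%:R - 1) <= ln #|factors|%:R :> R.
  have : ln (d%:R ^+ n) <= ln (expR 1 ^+ n * #|factors|%:R) :> R.
    by rewrite ler_ln ?posrE ?mulr_gt0 ?exprn_gt0 ?expR_gt0.
  rewrite lnM ?posrE ?exprn_gt0 ?expR_gt0 // !lnXn ?expR_gt0 // expRK.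
  by rewrite -[ln _ *+ n]mulr_natl mulrBr mulr1 lerBlDl.
have upper := @sum_porbits_le R n d E Eout; rewrite -/factors in upper.
have stirling := @sum_ln_succ_le R d d0.
have half := @half_le_ln2 R.
have ln2d : ln 2 <= ln d%:R :> R by rewrite ler_ln ?posrE // ler_nat.
rewrite ler_pdivrMr // mulrA mulrAC ler_pdivlMr //.
set S : R := (\sum_(s in factors) _)%:R in upper *.
set P : R := #|factors|%:R in P0 lnP upper *.
have S0 : 0 <= S * d%:R by rewrite mulr_ge0 ?ler0n.
have PN0 : 0 <= P * n%:R by rewrite mulr_ge0 ?ler0n.
(* The terms [P * n * d * (ln d - 1)] cancel, leaving [S * d / 2 <= 2 * P * n * (ln d + 1)]; with
   [1 <= 2 * ln d] this gives the constant 12. *)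
have h1 := ler_wpM2l PN0 stirling.
have h2 := ler_wpM2l (mulr_ge0 (ltW P0) (ltW d0')) lnP.
have h3 : 2^-1 * (S * d%:R) <= ln 2 * (S * d%:R) by rewrite ler_wpM2r.
have h4 : P * n%:R * 1 <= P * n%:R * (2 * ln d%:R) by rewrite ler_wpM2l //; lra.
lra.
Qed.

Local Close Scope ring_scope.
From Stdlib Require Import Reals.

Theorem theorem1p1 :
  exists C : R, (0 < C)%R /\
    forall (n d : nat) (E : rel 'I_n),
      (1 <= n)%N -> (2 <= d)%N -> dregular d E ->
      (expected_num_cycles E <= C * (INR n * ln (INR d) / INR d))%R.
Proof.
exists (INR 12); split; first by apply/RltP; rewrite INRE ltr0n.
move=> n d E _ d2 Ereg; apply/RleP.
rewrite /expected_num_cycles !RdivE !INRE RlnE.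
have Eout v : #|[set w | E v w]| = d by have [] := Ereg v.
have Ein v : #|[set u | E u v]| = d by have [] := Ereg v.
exact: mean_porbits_le d2 Eout Ein.
Qed.
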